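(* Let $(M,g_{ab})$ be a connected 4-dimensional Lorentzian manifold whose metric belongs locally to the Kerr--NUT--(A)dS class, and let $Y_{ab}$ be its principal closed conformal Killing--Yano 2-form. Then there is no non-trivial conformal deformation $\tilde g_{ab}=e^{2u}g_{ab}$ (i.e. with $u\in C^\infty(M)$ non-constant) that defines a CKY--RS structure with soliton vector field $\xi[Y]$ and for which $\tilde Y=e^{3u}Y$ is again a principal closed conformal Killing--Yano 2-form (of $\tilde g$).
   Context: Conformal Killing--Yano (CKY) 2-form on an $n$-dimensional pseudo-Riemannian manifold: a smooth 2-form $Y_{ab}$ with $\nabla_cY_{ab}=g_{ca}\xi_b-g_{cb}\xi_a+z_{abc}$, where $z_{abc}$ is totally antisymmetric and $\xi_a=\frac{1}{n-1}\nabla^bY_{ba}$; $\xi^a=\xi^a[Y]$ is its associated vector field. It is closed if $dY=0$. In dimension 4, it is non-degenerate if $Y\wedge Y$ is nowhere zero. A principal closed CKY 2-form is here a closed, non-degenerate CKY 2-form. $\tilde g=e^{2u}g$ defines a CKY--RS structure with soliton vector field $\xi=\xi[Y]$ if there is $\lambda\in\mathbb{R}$ with $\tilde R_{ab}+\frac12\mathcal{L}_{\xi}\tilde g_{ab}=\lambda\tilde g_{ab}$, $\tilde R_{ab}$ being the Ricci tensor of $\tilde g$. The structure (deformation) is trivial if $u$ is constant. Kerr--NUT--(A)dS class in dimension 4 (standard local form): metrics locally of the form $$\frac{p^2+q^2}{P}\,dp^2+\frac{P}{p^2+q^2}(d\tau+q^2d\sigma)^2+\frac{p^2+q^2}{Q}\,dq^2-\frac{Q}{p^2+q^2}(d\tau-p^2d\sigma)^2,$$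 with $P=k+2Np-\varepsilon p^2-\frac{\Lambda}{3}p^4$, $Q=k-2mq+\varepsilon q^2-\frac{\Lambda}{3}q^4$, where $k,N,m,\varepsilon,\Lambda$ are real constants. *)

(* Defs.v *)
From mathcomp Require Import all_boot all_order all_algebra.
From mathcomp Require Import all_classical all_reals all_analysis.

Set Implicit Arguments.
Unset Strict Implicit.
Unset Printing Implicit Defensive.

Import Order.TTheory GRing.Theory Num.Theory.
Import numFieldNormedType.Exports.

Local Open Scope classical_set_scope.
Local Open Scope ring_scope.

Section Smooth.
Context {R : realType} {n : nat}.

Definition partial (i : 'I_n) (f : 'rV[R]_n -> R) : 'rV[R]_n -> R :=
  fun x => 'D_'e_i f x.

Fixpoint iter_partial (s : seq 'I_n) (f : 'rV[R]_n -> R) : 'rV[R]_n -> R :=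
  if s is i :: s' then partial i (iter_partial s' f) else f.

(* C^oo on U, for U open: all iterated partial derivatives exist and are
   continuous at the points of U *)
Definition smooth_on (U : set 'rV[R]_n) (f : 'rV[R]_n -> R) : Prop :=
  forall (s : seq 'I_n) (x : 'rV[R]_n), U x ->
    {for x, continuous (iter_partial s f)} /\
    forall i : 'I_n, derivable (iter_partial s f) x 'e_i.

Definition smooth_map_on (m : nat) (U : set 'rV[R]_n)
    (f : 'rV[R]_n -> 'rV[R]_m) : Prop :=
  forall j : 'I_m, smooth_on U (fun x => f x 0 j).

End Smooth.

(* [chart_map] and [chart_inv] are only meaningful on [chart_dom] and on its
   image; their values elsewhere are junk. *)
Record chart (R : realType) (n : nat) (T : topologicalType) := Chart {
  chart_dom : set T ;
  chart_map :> T -> 'rV[R]_n ;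
  chart_inv : 'rV[R]_n -> T ;
  chart_open_dom : open chart_dom ;
  chart_open_image : open (chart_map @` chart_dom) ;
  chart_mapK : {in chart_dom, cancel chart_map chart_inv} ;
  chart_map_continuous : {within chart_dom, continuous chart_map} ;
  chart_inv_continuous :
    {within chart_map @` chart_dom, continuous chart_inv} }.

Definition chart_image {R : realType} {n : nat} {T : topologicalType}
  (c : chart R n T) : set 'rV[R]_n := c @` chart_dom c.

Definition transition {R : realType} {n : nat} {T : topologicalType}
  (c d : chart R n T) : 'rV[R]_n -> 'rV[R]_n := d \o chart_inv c.

Definition compatible {R : realType} {n : nat} {T : topologicalType}
    (c d : chart R n T) : Prop :=
  smooth_map_on (c @` (chart_dom c `&` chart_dom d)) (transition c d) /\
  smooth_map_on (d @` (chart_dom c `&` chart_dom d)) (transition d c).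

(* [atlas_maximal], read from left to right, also says that the charts of the
   atlas are pairwise compatible. *)
Record smoothManifold (R : realType) (n : nat) := SmoothManifold {
  manifold_carrier :> topologicalType ;
  manifold_hausdorff : hausdorff_space manifold_carrier ;
  manifold_second_countable : @second_countable manifold_carrier ;
  atlas : set (chart R n manifold_carrier) ;
  atlas_cover : forall x : manifold_carrier,
    exists2 c, atlas c & chart_dom c x ;
  atlas_maximal : forall c, atlas c <-> (forall d, atlas d -> compatible c d) }.

Arguments atlas {R n} s.

Definition smooth_scalar {R : realType} {n : nat} (M : smoothManifold R n)
    (u : M -> R) : Prop :=
  forall c, atlas M c -> smooth_on (chart_image c) (u \o chart_inv c).

(* In this section tensor fields are given by their components in one
   coordinate system (Levi-Civita connection and curvature of the metric G
   included): [G x a b] is g_ab at x, [Y x a b] is Y_ab, and [X x 0 a]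
   is the a-th component of a vector or covector field. *)

Section Local.
Context {R : realType} {n : nat}.
Implicit Types (G Y : 'rV[R]_n -> 'M[R]_n) (X : 'rV[R]_n -> 'rV[R]_n).
Implicit Types (x : 'rV[R]_n) (a b c d e : 'I_n).

(* [christoffel G d a b] is Gamma^d_{ab} *)
Definition christoffel G d a b x : R :=
  2^-1 * \sum_(e < n) invmx (G x) d e *
    (partial a (fun y => G y e b) x + partial b (fun y => G y e a) x
     - partial e (fun y => G y a b) x).

(* [cov_deriv2 G Y c a b] is nabla_c Y_ab: the derivative index comes first *)
Definition cov_deriv2 G Y c a b x : R :=
  partial c (fun y => Y y a b) x
  - \sum_(d < n) christoffel G d c a x * Y x d b
  - \sum_(d < n) christoffel G d c b x * Y x a d.

(* xi_a = (n-1)^-1 nabla^b Y_ba *)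
Definition cky_covector G Y x : 'rV[R]_n :=
  \row_a ((n%:R - 1)^-1 *
    \sum_(b < n) \sum_(c < n) invmx (G x) b c * cov_deriv2 G Y c b a x).

(* xi^a = g^ab xi_b *)
Definition cky_vector G Y x : 'rV[R]_n :=
  \row_a \sum_(b < n) invmx (G x) a b * cky_covector G Y x 0 b.

Definition totally_antisymmetric (z : 'I_n -> 'I_n -> 'I_n -> R) : Prop :=
  forall a b c, z a b c = - z b a c /\ z a b c = - z a c b.

(* The equation determines z, so that asking for z point by point amounts to
   asking for a tensor field z. *)
Definition cky_equation G Y x : Prop :=
  exists z : 'I_n -> 'I_n -> 'I_n -> R, totally_antisymmetric z /\
    forall a b c, cov_deriv2 G Y c a b x =
      G x c a * cky_covector G Y x 0 b - G x c b * cky_covector G Y x 0 a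
      + z a b c.

(* (dY)_abc, for an antisymmetric Y *)
Definition ext_deriv2 Y a b c x : R :=
  partial a (fun y => Y y b c) x + partial b (fun y => Y y c a) x
  + partial c (fun y => Y y a b) x.

(* (A /\ B)_abcd, the sum over shuffles, for antisymmetric A and B *)
Definition wedge22 (A B : 'M[R]_n) a b c d : R :=
  A a b * B c d - A a c * B b d + A a d * B b c
  + A b c * B a d - A b d * B a c + A c d * B a b.

(* R^d_{cab}, with (nabla_a nabla_b - nabla_b nabla_a) V^d = R^d_{cab} V^c *)
Definition riemann G d c a b x : R :=
  partial a (christoffel G d b c) x - partial b (christoffel G d a c) x
  + \sum_(e < n) (christoffel G d a e x * christoffel G e b c x
                  - christoffel G d b e x * christoffel G e a c x).

Definition ricci G x : 'M[R]_n := \matrix_(a, b) \sum_(c < n) riemann G c a c b x.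

Definition lie_deriv2 X G x : 'M[R]_n :=
  \matrix_(a, b) \sum_(c < n)
    (X x 0 c * partial c (fun y => G y a b) x
     + G x c b * partial a (fun y => X y 0 c) x
     + G x a c * partial b (fun y => X y 0 c) x).

End Local.

(* A vector field, resp. a covariant 2-tensor field, is represented by the
   family of its components in all charts (only the values on the images of
   the charts of the atlas are meaningful). *)
Definition vectorComponents {R : realType} {n : nat} (M : smoothManifold R n) :=
  chart R n M -> 'rV[R]_n -> 'rV[R]_n.

Definition tensor2Components {R : realType} {n : nat} (M : smoothManifold R n) :=
  chart R n M -> 'rV[R]_n -> 'M[R]_n.

Section Fields.
Context {R : realType} {n : nat} {M : smoothManifold R n}.
Implicit Types (g Y T : tensor2Components M) (X : vectorComponents M).

(* [jacobian] acts on row vectors: ['J f x i a] is the partial derivative of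
   the a-th component of f in the i-th direction. *)
Definition smooth_tensor2 T : Prop :=
  (forall c, atlas M c ->
     forall a b, smooth_on (chart_image c) (fun x => T c x a b)) /\
  (forall c d, atlas M c -> atlas M d ->
     forall p : M, chart_dom c p -> chart_dom d p ->
     let J := jacobian (transition c d) (c p) in
     T c (c p) = J *m T d (d p) *m J^T).

Definition two_form Y : Prop :=
  smooth_tensor2 Y /\
  forall c x, atlas M c -> chart_image c x -> (Y c x)^T = - Y c x.

Definition minkowski_form : 'M[R]_n :=
  diag_mx (\row_(i < n) (if i == 0%N :> nat then -1 else 1)).

Definition lorentzian_metric g : Prop :=
  smooth_tensor2 g /\
  forall c x, atlas M c -> chart_image c x ->
    (g c x)^T = g c x /\
    exists2 E : 'M[R]_n, E \in unitmx & E *m g c x *m E^T = minkowski_form.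

Definition cky_form g Y : Prop :=
  two_form Y /\
  forall c x, atlas M c -> chart_image c x -> cky_equation (g c) (Y c) x.

Definition closed_form Y : Prop :=
  forall c x, atlas M c -> chart_image c x ->
    forall i j k, ext_deriv2 (Y c) i j k x = 0.

Definition cky_vector_field g Y : vectorComponents M :=
  fun c => cky_vector (g c) (Y c).

Definition conformal_rescaling (w : R) (u : M -> R) T : tensor2Components M :=
  fun c x => expR (w * u (chart_inv c x)) *: T c x.

Definition ricci_soliton g X : Prop :=
  exists lambda : R, forall c x, atlas M c -> chart_image c x ->
    ricci (g c) x + 2^-1 *: lie_deriv2 (X c) (g c) x = lambda *: g c x.

(* The soliton vector field is xi^a[Y] computed with g, not with e^{2u} g. *)
Definition cky_rs_structure g Y (u : M -> R) : Prop :=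
  ricci_soliton (conformal_rescaling 2 u g) (cky_vector_field g Y).

Definition trivial_deformation (u : M -> R) : Prop :=
  exists k : R, forall p, u p = k.

End Fields.

Definition nondegenerate_form {R : realType} {M : smoothManifold R 4}
    (Y : tensor2Components M) : Prop :=
  forall c x, atlas M c -> chart_image c x ->
    exists i j k l, wedge22 (Y c x) (Y c x) i j k l != 0.

Definition principal_closed_cky {R : realType} {M : smoothManifold R 4}
    (g Y : tensor2Components M) : Prop :=
  [/\ cky_form g Y, closed_form Y & nondegenerate_form Y].

Definition covector_square {R : realType} (w : 'rV[R]_4) : 'M[R]_4 := w^T *m w.

Section KerrNUTAdS.
Context {R : realType}.
Context (k N m eps Lam : R).

Definition kerr_P (p : R) : R :=
  k + 2 * N * p - eps * p ^+ 2 - Lam / 3 * p ^+ 4.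

Definition kerr_Q (q : R) : R :=
  k - 2 * m * q + eps * q ^+ 2 - Lam / 3 * q ^+ 4.

(* coordinates x = (p, q, tau, sigma) *)
Definition kerr_metric (x : 'rV[R]_4) : 'M[R]_4 :=
  let p := x 0 0 in
  let q := x 0 1 in
  let dp : 'rV[R]_4 := 'e_0 in
  let dq : 'rV[R]_4 := 'e_1 in
  let dtau : 'rV[R]_4 := 'e_2 in
  let dsigma : 'rV[R]_4 := 'e_3 in
  let S := p ^+ 2 + q ^+ 2 in
  let P := kerr_P p in
  let Q := kerr_Q q in
    (S / P) *: covector_square dp + (P / S) *: covector_square (dtau + q ^+ 2 *: dsigma)
  + (S / Q) *: covector_square dq - (Q / S) *: covector_square (dtau - p ^+ 2 *: dsigma).

(* where no denominator of [kerr_metric] vanishes (division by 0 gives 0) *)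
Definition kerr_domain : set 'rV[R]_4 :=
  [set x | [/\ x 0 0 ^+ 2 + x 0 1 ^+ 2 != 0, kerr_P (x 0 0) != 0
             & kerr_Q (x 0 1) != 0]].

End KerrNUTAdS.

(* The constants may depend on the coordinate patch. *)
Definition locally_kerr_nut_ads {R : realType} {M : smoothManifold R 4}
    (g : tensor2Components M) : Prop :=
  forall p : M, exists2 c, atlas M c /\ chart_dom c p &
    exists k N m eps Lam : R, forall x, chart_image c x ->
      kerr_domain k N m eps Lam x /\ g c x = kerr_metric k N m eps Lam x.

(* Main.v *)
Require Import Defs.
From mathcomp Require Import all_boot all_order all_algebra.
From mathcomp Require Import all_classical all_reals all_analysis.
From mathcomp Require Import ring lra.

Import Order.TTheory GRing.Theory Num.Theory.
Import numFieldNormedType.Exports.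

Local Open Scope classical_set_scope.
Local Open Scope ring_scope.

(** If [dY = 0] and [d (e^{3u} Y) = 0], then [du /\ Y = 0].  In dimension 4 the
    wedge product with a non-degenerate 2-form is injective on covectors, so
    [du = 0] and [u] is constant on the connected manifold. *)

(** Both sides have the same difference quotient, as [(h + t) *: v + z] is [h *: v + (t *: v + z)].
    This brings directional derivatives within reach of one-variable calculus. *)
Lemma is_derive_along_line {R : realType} {V W : normedModType R}
    (f : V -> W) (z v : V) (t : R) (l : W) :
  is_derive t 1 (fun h : R => f (h *: v + z)) l <-> is_derive (t *: v + z) v f l.
Proof.
have E : (fun h : R =>
    h^-1 *: (((fun h : R => f (h *: v + z)) \o shift t) (h *: (1 : R)) - f (t *: v + z)))
  = (fun h : R => h^-1 *: ((f \o shift (t *: v + z)) (h *: v) - f (t *: v + z))).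
  by apply/funext => h /=; rewrite [h *: 1]mulr1 scalerDl addrA.
by split=> -[df <-]; split; move: df; rewrite /derivable /derive ?E.
Qed.

Lemma is_derive_expR_comp {R : realType} {V : normedModType R} (f : V -> R)
    (x v : V) (l : R) :
  is_derive x v f l -> is_derive x v (expR \o f) (expR (f x) * l).
Proof.
have x0 : x = 0 *: v + x by rewrite scale0r add0r.
rewrite {1}x0 => /is_derive_along_line fl; rewrite {1}x0.
apply/is_derive_along_line.
suff -> : f x = f (0 *: v + x) by exact: is_derive1_comp.
by rewrite -x0.
Qed.

(** Mean value theorem on the segment between [0] and [s]; the bound on [|t|] covers both signs of
    [s]. *)
Lemma constant_along_line {R : realType} {V : normedModType R}
    (f : V -> R) (z v : V) (s : R) :
  (forall t, `|t| <= `|s| -> is_derive (t *: v + z) v f 0) ->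
  f (s *: v + z) = f z.
Proof.
move=> df; pose g (h : R) := f (h *: v + z).
have dg (t : R) : `|t| <= `|s| -> is_derive t 1 g 0.
  by move=> ts; apply/is_derive_along_line; exact: df.
suff : g s = g 0 by rewrite /g scale0r add0r.
have cg (a b : R) : {in `[a, b], forall t, `|t| <= `|s|} ->
    {within `[a, b], continuous g}.
  move=> abs; apply: derivable_within_continuous => t /abs ts.
  by have [] := dg t ts.
have [s0|s0] := leP 0 s.
  have H : {in `[0, s], forall t, `|t| <= `|s|}.
    by move=> t; rewrite in_itv /= => /andP[t0 ts]; rewrite !ger0_norm.
  have [t /subset_itv_oo_cc/H/dg//||c _] := MVT_segment s0 (f := g) (df := cst 0).
    exact: cg.
  by rewrite mul0r => /eqP; rewrite subr_eq0 => /eqP.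
have H : {in `[s, 0], forall t, `|t| <= `|s|}.
  move=> t; rewrite in_itv /= => /andP[st t0].
  by rewrite !ler0_norm ?lerN2// ltW.
have [t /subset_itv_oo_cc/H/dg//||c _] :=
  MVT_segment (ltW s0) (f := g) (df := cst 0).
  exact: cg.
by rewrite mul0r => /eqP; rewrite subr_eq0 => /eqP.
Qed.

(* A ball for the sup norm is a box: join its center to any of its points by a
   path parallel to the axes. *)
Lemma constant_on_ball {R : realType} {n : nat} (f : 'rV[R]_n -> R)
    (x : 'rV[R]_n) (r : R) :
  (forall y i, ball x r y -> is_derive y 'e_i f 0) ->
  forall y, ball x r y -> f y = f x.
Proof.
move=> df y [r0 xy].
pose z k : 'rV[R]_n := \row_j (if (j < k)%N then y 0 j else x 0 j).
suff zx k : (k <= n)%N -> f (z k) = f x.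
  rewrite -(zx n)//; congr f; apply/rowP => j.
  by rewrite mxE ltn_ord.
elim: k => [|k IH] kn.
  by congr f; apply/rowP => j; rewrite mxE ltn0.
rewrite -(IH (ltnW kn)).
pose i := Ordinal kn; pose s := y 0 i - x 0 i.
have -> : z k.+1 = s *: 'e_i + z k.
  apply/rowP => j; rewrite !mxE eqxx /= ltnS leq_eqVlt.
  have -> : (j == k :> nat) = (j == i) by [].
  have [->|ji] := eqVneq j i; first by rewrite /= ltnn mulr1 /s subrK.
  by rewrite /= mulr0 add0r.
apply: constant_along_line => t ts; apply: df; split=> // a j.
rewrite (ord1 a) !mxE eqxx /=.
have := xy 0 j; rewrite /ball /=.
(* Coordinate [i] of the point is [x 0 i + t] with [|t| <= |y 0 i - x 0 i|]; every other coordinate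
   is that of [x] or of [y]. *)
have [->|ji] := eqVneq j i.
  rewrite /= ltnn mulr1 distrC => yr.
  by rewrite opprD addrCA subrr addr0 normrN (le_lt_trans ts).
rewrite mulr0 add0r; case: ifP => // _ _.
by rewrite subrr normr0.
Qed.

Lemma locally_constant_connected {T : topologicalType} {A : Type} (u : T -> A) :
  connected [set: T] -> (forall p, \forall q \near p, u q = u p) ->
  forall p q, u q = u p.
Proof.
move=> cT lu p q.
(* An arbitrary predicate [B] serves both the level set of [u p] and its complement, so the level
   set is clopen. *)
have opn B : open [set z | B (u z)].
  rewrite openE => z Bz; rewrite /interior; apply: filterS (lu z) => w /= ->.
  exact: Bz.
suff E : [set z | u z = u p] = [set: T] by have : [set: T] q by []; rewrite -E.
apply: cT.
- by exists p.
- by exists [set z | u z = u p]; [exact: (opn (fun a => a = u p))|rewrite setTI].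
- exists [set z | u z = u p]; last by rewrite setTI.
  rewrite -(setCK [set z | u z = u p]); apply: open_closedC.
  exact: (opn (fun a => a <> u p)).
Qed.

(** A repeated index kills the component by antisymmetry, so the four indices are distinct and fill
    ['I_4]. *)
Lemma wedge22_neq0_covering {R : realType} (B : 'M[R]_4) (i j k l e : 'I_4) :
  B^T = - B -> wedge22 B B i j k l != 0 -> [\/ e = i, e = j, e = k | e = l].
Proof.
move=> BT W.
have aB a b : B b a = - B a b.
  by have := congr1 (fun M : 'M[R]_4 => M a b) BT; rewrite !mxE.
have B0 a : B a a = 0 by have := aB a a; lra.
have uniq_ijkl : uniq [:: i; j; k; l].
  apply: contraNT W; rewrite /= !inE !negb_or !andbT !negb_and !negbK.
  rewrite /wedge22 -!orbA => /or4P[/eqP<-|/eqP<-|/eqP<-|/or3P[/eqP<-|/eqP<-|/eqP<-]];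
  by apply/eqP; rewrite ?B0 ?(aB i j) ?(aB i k) ?(aB i l) ?(aB j k) ?(aB j l) ?(aB k l); ring.
have sub : {subset [:: i; j; k; l] <= enum 'I_4} by move=> x _; rewrite mem_enum.
have [|_ E] := uniq_min_size uniq_ijkl sub; first by rewrite size_enum_ord.
have : e \in [:: i; j; k; l] by rewrite E mem_enum.
by rewrite !inE => /or4P[] /eqP ->; [apply: Or41|apply: Or42|apply: Or43|apply: Or44].
Qed.

(* [al /\ B = 0] forces [al_i (B /\ B)_ijkl = 0] (no sum over i), and the indices
   of a nonzero component of [B /\ B] exhaust the four directions. *)
Lemma wedge_nondegenerate_eq0 {R : realType} (B : 'M[R]_4) (al : 'I_4 -> R) :
  B^T = - B -> (exists i j k l, wedge22 B B i j k l != 0) ->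
  (forall a b c, al a * B b c + al b * B c a + al c * B a b = 0) ->
  forall e, al e = 0.
Proof.
move=> BT [i [j [k [l W]]]] aB0 e.
have aB a b : B b a = - B a b.
  by have := congr1 (fun M : 'M[R]_4 => M a b) BT; rewrite !mxE.
have first a b c d : al a * wedge22 B B a b c d = 0.
  have T1 := aB0 a b c; have T2 := aB0 a c d; have T3 := aB0 a b d.
  (* Each bracket is a component of [al /\ B]. The terms in [al a] add up to the left-hand side, and
     those in [al b], [al c], [al d] cancel by antisymmetry. *)
  transitivity (2 * (B a b * (al a * B c d + al c * B d a + al d * B a c)
    - B a c * (al a * B b d + al b * B d a + al d * B a b)
    + B a d * (al a * B b c + al b * B c a + al c * B a b))).
    by rewrite /wedge22 (aB a c) (aB a d); ring.
  by rewrite T1 T2 T3; ring.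
have W_al a b c d : wedge22 B B a b c d != 0 -> al a = 0.
  by move=> /negPf W0; have /eqP := first a b c d; rewrite mulf_eq0 W0 orbF => /eqP.
(* Swapping [i] with the index equal to [e] only changes the sign of the component, so it stays
   nonzero with [e] in front. *)
have [->|->|->|->] := wedge22_neq0_covering _ i j k l e BT W.
- exact: W_al W.
- apply: (W_al j i k l); apply: contraNneq W => W'; apply/eqP; rewrite -oppr0 -W'.
  by rewrite /wedge22 (aB i j); ring.
- apply: (W_al k j i l); apply: contraNneq W => W'; apply/eqP; rewrite -oppr0 -W'.
  by rewrite /wedge22 (aB i j) (aB i k) (aB j k); ring.
- apply: (W_al l j k i); apply: contraNneq W => W'; apply/eqP; rewrite -oppr0 -W'.
  by rewrite /wedge22 (aB i j) (aB i k) (aB i l) (aB j l) (aB k l); ring.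
Qed.

(** The Leibniz rule [d (e^{wf} B) = e^{wf} (dB + w df /\ B)] in components: if both forms are
    closed and [w] is nonzero, then [df /\ B = 0]. *)
Lemma ext_deriv2_expR_scale {R : realType} {n : nat} (w : R)
    (f : 'rV[R]_n -> R) (B : 'rV[R]_n -> 'M[R]_n) (x : 'rV[R]_n) (a b c : 'I_n) :
  (forall i, derivable f x 'e_i) ->
  (forall i b c, derivable (fun y => B y b c) x 'e_i) ->
  ext_deriv2 (fun y => expR (w * f y) *: B y) a b c x =
  expR (w * f x) * (ext_deriv2 B a b c x
    + w * (partial a f x * B x b c + partial b f x * B x c a
           + partial c f x * B x a b)).
Proof.
move=> df dB.
have E i b' c' : partial i (fun y => (expR (w * f y) *: B y) b' c') x =
    expR (w * f x) * (partial i (fun y => B y b' c') x + w * (partial i f x * B x b' c')).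
  rewrite /partial.
  have -> : (fun y => (expR (w * f y) *: B y) b' c') =
      (expR \o (w \*: f)) * (fun y => B y b' c').
    by apply/funext => y; rewrite mxE.
  have d1 : is_derive x 'e_i (expR \o (w \*: f)) (expR (w * f x) * (w * 'D_'e_i f x)).
    by apply: is_derive_expR_comp; apply: is_deriveZ; exact/derivableP.
  have d2 : is_derive x 'e_i (fun y => B y b' c') ('D_'e_i (fun y => B y b' c') x).
    exact/derivableP.
  rewrite (@derive_val _ _ _ _ _ _ _ (is_deriveM d1 d2)) /= /GRing.scale /=; ring.
by rewrite /ext_deriv2 !E; ring.
Qed.

Theorem mainTheorem3 (R : realType) (M : smoothManifold R 4)
    (g Y : tensor2Components M) :
  connected [set: M] ->
  lorentzian_metric g ->
  locally_kerr_nut_ads g ->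
  principal_closed_cky g Y ->
  ~ exists u : M -> R,
      [/\ smooth_scalar u,
          ~ trivial_deformation u,
          cky_rs_structure g Y u
        & principal_closed_cky (conformal_rescaling 2 u g)
                               (conformal_rescaling 3 u Y)].
Proof.
(* Applying the non-triviality of [u] leaves the goal that [u] is constant. *)
move=> cM _ _ [[[[sY _] aY] _] dY nY] [u [su + _ [_ dY' _]]]; apply.
have du c x i : atlas M c -> chart_image c x ->
    is_derive x 'e_i (u \o chart_inv c) 0.
  move=> Mc cx; have df j := (su c Mc [::] x cx).2 j.
  have dB j a b := (sY c Mc a b [::] x cx).2 j.
  suff du0 : partial i (u \o chart_inv c) x = 0 by rewrite -du0; exact/derivableP/df.
  apply: (@wedge_nondegenerate_eq0 _ (Y c x) (fun j => partial j (u \o chart_inv c) x)).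
  - exact: aY.
  - exact: nY.
  - move=> a b d; have := dY' c x Mc cx a b d.
    rewrite (ext_deriv2_expR_scale 3 (u \o chart_inv c)) // dY // add0r.
    (* The factors [e^{3u}] and [3] are nonzero, which leaves [du /\ Y = 0]. *)
    move/eqP; rewrite !mulf_eq0 gt_eqF ?expR_gt0 //= pnatr_eq0 /=.
    by move/eqP.
have lu (p : M) : \forall q \near p, u q = u p.
  have [c Mc cp] := atlas_cover p.
  have cpi : chart_image c (c p) by exists p.
  have /nbhs_ballP[r /= r0 rc] : nbhs (c p) (chart_image c).
    by apply: open_nbhs_nbhs; split => //; exact: chart_open_image.
  have cst_r := @constant_on_ball _ _ (u \o chart_inv c) (c p) r
    (fun y i cy => du c y i Mc (rc y cy)).
  have near_dom : \forall q \near p, chart_dom c q.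
    by apply: open_nbhs_nbhs; split => //; exact: chart_open_dom.
  have near_ball : \forall q \near p, ball (c p) r (c q).
    have := @chart_map_continuous _ _ _ c.
    (* The chart map is continuous within its domain; openness of the domain turns this into
       continuity at [p] in [M]. *)
    rewrite continuous_open_subspace; last exact: chart_open_dom.
    by move=> /(_ p (mem_set cp)); apply; exact: nbhsx_ballx.
  near=> q.
  have cq : chart_dom c q by near: q.
  have := cst_r (c q); rewrite /= !chart_mapK ?inE //; apply.
  by near: q.
(* The constant is the value of [u] at any point; on an empty [M], [0] will do. *)
have [[p _]|noM] := pselect ([set: M] !=set0).
  by exists (u p) => q; exact: locally_constant_connected.
by exists 0 => p; exfalso; apply: noM; exists p.
Unshelve. all: by end_near.
Qed.
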